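(* Let $\mathcal{E}$ be a (connected) coarse structure on an infinite set $X$ and let $Y$ be a large subset of $X$, i.e. a non-empty subset for which there exists $\varepsilon\in\mathcal{E}$ with $X=\bigcup_{y\in Y}B(y,\varepsilon)$. If the substructure $\mathcal{E}|_{Y}=\{\varepsilon\cap(Y\times Y):\varepsilon\in\mathcal{E}\}$ is $\vee$-decomposable (as a coarse structure on $Y$), then $\mathcal{E}$ is $\vee$-decomposable.
   Context: A coarse structure on a set $X$ is a family $\mathcal{E}$ of subsets of $X\times X$ such that: each $\varepsilon\in\mathcal{E}$ contains the diagonal $\Delta_X=\{(x,x):x\in X\}$; if $\varepsilon,\delta\in\mathcal{E}$ then $\varepsilon\circ\delta=\{(x,y):\exists z\,((x,z)\in\varepsilon,(z,y)\in\delta)\}\in\mathcal{E}$ and $\varepsilon^{-1}=\{(y,x):(x,y)\in\varepsilon\}\in\mathcal{E}$; if $\varepsilon\in\mathcal{E}$ and $\Delta_X\subseteq\varepsilon'\subseteq\varepsilon$ then $\varepsilon'\in\mathcal{E}$. Put $B(x,\varepsilon)=\{y\in X:(x,y)\in\varepsilon\}$. All coarse structures considered are connected: for any $x,y\in X$ there is $\varepsilon\in\mathcal{E}$ with $y\in B(x,\varepsilon)$. A subset $\mathcal{E}'\subseteq\mathcal{E}$ is a base of $\mathcal{E}$ if every $\varepsilon\in\mathcal{E}$ is contained in some $\varepsilon'\in\mathcal{E}'$. $\mathcal{E}_0\vee\mathcal{E}_1$ is the smallest (by inclusion) coarse structure on $X$ containing both $\mathcal{E}_0$ and $\mathcal{E}_1$.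 A coarse structure is cellular if it has a base consisting of equivalence relations. A coarse structure $\mathcal{E}$ on $X$ is $\vee$-decomposable if there exist two cellular coarse structures $\mathcal{E}_0,\mathcal{E}_1$ on $X$ with $\mathcal{E}=\mathcal{E}_0\vee\mathcal{E}_1$. *)

(* Defs.v *)
From mathcomp Require Import all_boot.
From mathcomp Require Import boolp classical_sets cardinality.

Set Implicit Arguments.
Unset Strict Implicit.
Unset Printing Implicit Defensive.

Local Open Scope classical_set_scope.
Local Open Scope relation_scope.

(* The carrier [X] is a subset of an ambient type [T], so that structures on a
   set and on its subsets have the same type.

   Pitfall: the library's [d \; e] is [set xy | exists2 z, e (xy.1, z) &
   d (z, xy.2)], so the composite {(x, y) : exists z, (x, z) in e and (z, y)
   in d}, written e o d in coarse geometry, is [d \; e].  The ball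
   B(x, e) = {y : (x, y) in e} is [xsection e x]. *)

Definition diagonal_on (T : Type) (X : set T) : set (T * T) :=
  diagonal `&` (X `*` X).

(* Connectedness is part of the definition: only connected coarse structures
   are considered, here and in [vee_decomposable]. *)
Record coarse_structure (T : Type) (X : set T) (E : set (set (T * T))) : Prop :=
  CoarseStructure {
    coarse_sub : forall e, E e -> e `<=` X `*` X;
    coarse_diag : forall e, E e -> diagonal_on X `<=` e;
    coarse_comp : forall e d, E e -> E d -> E (d \; e);
    coarse_inv : forall e, E e -> E e^-1;
    coarse_subset : forall e e', E e -> diagonal_on X `<=` e' -> e' `<=` e -> E e';
    coarse_connected : forall x y, X x -> X y -> exists2 e, E e & xsection e x y
  }.

Definition is_base (T : Type) (E' E : set (set (T * T))) : Prop :=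
  E' `<=` E /\ forall e, E e -> exists2 e', E' e' & e `<=` e'.

Record equivalence_on (T : Type) (X : set T) (e : set (T * T)) : Prop :=
  EquivalenceOn {
    equivalence_on_sub : e `<=` X `*` X;
    equivalence_on_refl : forall x, X x -> e (x, x);
    equivalence_on_sym : forall x y, e (x, y) -> e (y, x);
    equivalence_on_trans : forall x y z, e (x, y) -> e (y, z) -> e (x, z)
  }.

Definition cellular (T : Type) (X : set T) (E : set (set (T * T))) : Prop :=
  exists2 E', is_base E' E & E' `<=` equivalence_on X.

(* [smallest] is an intersection; [coarse_joinP] shows that it is itself a
   coarse structure, hence the least one containing [E0] and [E1]. *)
Definition coarse_join (T : Type) (X : set T) (E0 E1 : set (set (T * T))) :
    set (set (T * T)) :=
  smallest (coarse_structure X) (E0 `|` E1).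

Definition vee_decomposable (T : Type) (X : set T) (E : set (set (T * T))) : Prop :=
  exists E0 E1 : set (set (T * T)),
    [/\ coarse_structure X E0, coarse_structure X E1,
        cellular X E0, cellular X E1 & E = coarse_join X E0 E1].

Definition large (T : Type) (X : set T) (E : set (set (T * T))) (Y : set T) : Prop :=
  [/\ Y `<=` X, Y !=set0 &
      exists2 e, E e & X = \bigcup_(y in Y) xsection e y].

Definition coarse_restr (T : Type) (E : set (set (T * T))) (Y : set T) :
    set (set (T * T)) :=
  [set e `&` (Y `*` Y) | e in E].

Lemma coarse_full (T : Type) (X : set T) :
  coarse_structure X [set e | diagonal_on X `<=` e /\ e `<=` X `*` X].
Proof.
split.
- by move=> e [].
- by move=> e [].
- move=> e d [De eX] [Dd dX]; split.
    move=> [x y] xyD; exists x; last exact: (Dd (x, y)).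
    by apply: De; case: xyD => _ [/= Xx _]; split.
  by move=> [x y] [z /eX[Xx _] /dX[_ Xy]]; split.
- move=> e [De eX]; split.
    by move=> [x y] [/= xy [/= Xx Xy]]; apply: De; split.
  by move=> [x y] /eX [].
- by move=> e e' [_ eX] De' e'e; split=> // p /e'e /eX.
- move=> x y Xx Xy; exists (X `*` X); last by apply/xsectionP.
  by split=> // p [].
Qed.

Lemma coarse_joinP (T : Type) (X : set T) (E0 E1 : set (set (T * T))) :
  coarse_structure X E0 -> coarse_structure X E1 ->
  coarse_structure X (coarse_join X E0 E1).
Proof.
move=> c0 c1.
have jF e : coarse_join X E0 E1 e -> diagonal_on X `<=` e /\ e `<=` X `*` X.
  move=> je; apply: (je [set e | diagonal_on X `<=` e /\ e `<=` X `*` X]).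
  split; first exact: coarse_full.
  by move=> d [dE|dE]; split;
    [exact: (coarse_diag c0)|exact: (coarse_sub c0)
    |exact: (coarse_diag c1)|exact: (coarse_sub c1)].
split.
- by move=> e /jF[].
- by move=> e /jF[].
- by move=> e d je jd F FE; apply: (coarse_comp FE.1); [exact: je|exact: jd].
- by move=> e je F FE; apply: (coarse_inv FE.1); exact: je.
- by move=> e e' je De' e'e F FE; apply: (coarse_subset FE.1 (je F FE)).
- move=> x y Xx Xy; have [e E0e exy] := coarse_connected c0 Xx Xy.
  by exists e => // F [_ E01F]; apply: E01F; left.
Qed.

(* Main.v *)
Require Import Defs.
From mathcomp Require Import all_boot.
From mathcomp Require Import boolp classical_sets cardinality.

(** Choose a retraction [f : X -> Y] that moves every point within a fixed
    entourage of [E]. If [E|Y = E0 \/ E1], then [E] is the join of the pullbacks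
    of [E0] and [E1] along [f]: pullbacks of equivalence relations are
    equivalence relations, closeness of [f] to the identity puts the pullbacks
    inside [E], and if a structure [F] on [X] contains both pullbacks, then the
    entourages of [Y] whose preimage lies in [F] form a coarse structure
    containing [E0] and [E1], hence all of [E|Y]. *)

Set Implicit Arguments.
Unset Strict Implicit.
Unset Printing Implicit Defensive.

Local Open Scope classical_set_scope.
Local Open Scope relation_scope.

Section Pullback.
Context {T : Type} (X Y : set T) (f : T -> T).
Hypothesis fXY : forall x, X x -> Y (f x).

Definition pullback_rel (d : set (T * T)) : set (T * T) :=
  (X `*` X) `&` [set p | d (f p.1, f p.2)].

(** The largest coarse structure on [X] for which [f] is a coarse map into [(Y, D)]. The relations
    [pullback_rel d] form only a base, hence the closure under smaller reflexive relations. *)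
Definition pullback_coarse (D : set (set (T * T))) : set (set (T * T)) :=
  [set e | diagonal_on X `<=` e /\ exists2 d, D d & e `<=` pullback_rel d].

Lemma pullback_rel_diag d : diagonal_on Y `<=` d -> diagonal_on X `<=` pullback_rel d.
Proof.
move=> Yd [x y] [/= xy [/= Xx Xy]]; split=> //=; apply: Yd.
by split; [exact: (congr1 f xy)|split; exact: fXY].
Qed.

Lemma pullback_rel_mem D d : coarse_structure Y D -> D d ->
  pullback_coarse D (pullback_rel d).
Proof.
move=> cD Dd; split; last by exists d.
exact: (pullback_rel_diag (coarse_diag cD Dd)).
Qed.

Lemma pullback_coarse_structure D :
  coarse_structure Y D -> coarse_structure X (pullback_coarse D).
Proof.
move=> cD; split.
- by move=> e [_ [d _ ed]] p /ed[].
- by move=> e [].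
- move=> e e' [Xe [d Dd ed]] [Xe' [d' Dd' ed']]; split.
    move=> [x y] xyX; exists x; last exact: (Xe' (x, y)).
    by apply: Xe; case: xyX => _ [/= Xx _]; split.
  exists (d' \; d); first exact: (coarse_comp cD).
  move=> [x y] [z /ed[[/= Xx _] dxz] /ed'[[/= _ Xy] dzy]]; split=> //=.
  by exists (f z).
- move=> e [Xe [d Dd ed]]; split.
    by move=> [x y] [/= xy [/= Xx Xy]]; apply: Xe; split; first exact: esym.
  exists d^-1; first exact: (coarse_inv cD).
  by move=> [x y] /ed[[/= Xy Xx] dyx]; split.
- move=> e e' [_ [d Dd ed]] Xe' e'e; split=> //; exists d => //.
  exact: (subset_trans e'e ed).
- move=> x y Xx Xy.
  have [d Dd /xsectionP dxy] := coarse_connected cD (fXY Xx) (fXY Xy).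
  by exists (pullback_rel d); [exact: pullback_rel_mem|apply/xsectionP; split].
Qed.

Lemma pullback_rel_equivalence d :
  equivalence_on Y d -> equivalence_on X (pullback_rel d).
Proof.
move=> [_ dr ds dt]; split.
- by move=> p [].
- by move=> x Xx; split=> //=; apply/dr/fXY.
- by move=> x y [[/= Xx Xy] /= dxy]; split=> //=; exact: ds.
- move=> x y z [[/= Xx _] /= dxy] [[/= _ Xz] /= dyz]; split=> //=.
  exact: dt dyz.
Qed.

(** Since [pullback_rel] is monotone, it carries a base of [D] to a base of the pullback. *)
Lemma pullback_cellular D :
  coarse_structure Y D -> cellular Y D -> cellular X (pullback_coarse D).
Proof.
move=> cD [B [BD baseB] Beq]; exists [set pullback_rel d | d in B].
  split; first by move=> _ [d Bd <-]; apply: pullback_rel_mem => //; exact: BD.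
  move=> e [_ [d Dd ed]]; have [d' Bd' dd'] := baseB d Dd.
  by exists (pullback_rel d'); [exists d'|move=> p /ed[Xp /dd']].
by move=> _ [d Bd <-]; apply: pullback_rel_equivalence; exact: Beq.
Qed.

(** From here on [f] is a retraction. In [pullback_relM] the intermediate point [z] between [f x]
    and [f y] lies in [Y], so it is fixed by [f] and can itself serve as the intermediate point
    between [x] and [y]. *)
Hypotheses (YX : Y `<=` X) (fid : forall y, Y y -> f y = y).

Lemma pullback_relM d e : d `<=` Y `*` Y ->
  pullback_rel (e \; d) `<=` pullback_rel e \; pullback_rel d.
Proof.
move=> dY [x y] [[/= Xx Xy] [z dxz dzy]].
have [/= _ Yz] := dY _ dxz.
by exists z; split; rewrite /= ?(fid Yz) //; split=> //=; exact: YX.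
Qed.

(** Each closure axiom is transferred from [F] by shrinking an entourage, with [pullback_relM]
    handling composition. The structure [D] supplies connectedness. *)
Lemma pushforward_coarse_structure D F :
  coarse_structure Y D -> coarse_structure X F -> pullback_coarse D `<=` F ->
  coarse_structure Y
    [set d | [/\ diagonal_on Y `<=` d, d `<=` Y `*` Y & F (pullback_rel d)]].
Proof.
move=> cD cF DF; split.
- by move=> d [].
- by move=> d [].
- move=> d e [Yd dY Fd] [Ye eY Fe].
  have Yde : diagonal_on Y `<=` e \; d.
    move=> [x y] xyY; exists x; last exact: (Ye (x, y)).
    by apply: Yd; case: xyY => _ [/= Yx _]; split.
  split=> //; first by move=> [x y] [z /dY[Yx _] /eY[_ Yy]].
  apply: (coarse_subset cF (coarse_comp cF Fd Fe)).
    exact: pullback_rel_diag.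
  exact: pullback_relM.
- move=> d [Yd dY Fd].
  have Yd' : diagonal_on Y `<=` d^-1.
    by move=> [x y] [/= xy [/= Yx Yy]]; apply: Yd; split; first exact: esym.
  split=> //; first by move=> [x y] /dY[].
  apply: (coarse_subset cF (coarse_inv cF Fd)); first exact: pullback_rel_diag.
  by move=> [x y] [[/= Xx Xy] dyx]; split.
- move=> d d' [_ dY Fd] Yd' d'd; split=> //; first exact: subset_trans dY.
  apply: (coarse_subset cF Fd); first exact: pullback_rel_diag.
  by move=> p [Xp /d'd].
- move=> x y Yx Yy; have [d Dd dxy] := coarse_connected cD Yx Yy.
  exists d => //; split.
  + exact: (coarse_diag cD).
  + exact: (coarse_sub cD).
  + exact/DF/pullback_rel_mem.
Qed.

Lemma pullback_coarse_join D0 D1 :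
  coarse_structure Y D0 -> coarse_structure Y D1 ->
  coarse_join X (pullback_coarse D0) (pullback_coarse D1) =
  pullback_coarse (coarse_join Y D0 D1).
Proof.
move=> c0 c1; apply/seteqP; split=> e.
  (* Minimality of the join on [X] is tested against the pullback of the join on [Y]. *)
  apply; split; first exact/pullback_coarse_structure/coarse_joinP.
  by move=> d [] [Xd [d' Dd' dd']]; split=> //; exists d' => // F [_]; apply;
    [left|right].
move=> [Xe [d jd ed]] F [cF DF].
have DF0 : pullback_coarse D0 `<=` F by move=> g Dg; apply: DF; left.
have DF1 : pullback_coarse D1 `<=` F by move=> g Dg; apply: DF; right.
(* Minimality of the join on [Y] is tested against the pushforward of [F], which puts
   [pullback_rel d] in [F]. *)
have [//|_ _ Fd] := jd _ (conj (pushforward_coarse_structure c0 cF DF0) _).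
  move=> g [Dg|Dg]; split.
  - exact: (coarse_diag c0).
  - exact: (coarse_sub c0).
  - exact/DF0/pullback_rel_mem.
  - exact: (coarse_diag c1).
  - exact: (coarse_sub c1).
  - exact/DF1/pullback_rel_mem.
exact: (coarse_subset cF Fd).
Qed.

Lemma pullback_coarse_restr E r : coarse_structure X E -> E r ->
  (forall x, X x -> r (f x, x)) -> pullback_coarse (coarse_restr E Y) = E.
Proof.
move=> cE Er rf; apply/seteqP; split=> e.
  move=> [Xe [_ [g Eg <-] eg]].
  (* The path from [x] to [y] runs through [f x] and [f y], along [r^-1], [g] and [r]. *)
  apply: (coarse_subset cE (coarse_comp cE
    (coarse_comp cE (coarse_inv cE Er) Eg) Er)) => // -[x y] /eg[[/= Xx Xy] [/= gxy _]].
  by exists (f y); [exists (f x)|]; rewrite //=; exact: rf.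
move=> Ee; split; first exact: (coarse_diag cE).
(* Conversely, [f x] is joined to [f y] through [x] and [y], along [r], [e] and [r^-1]. *)
exists ((r^-1 \; (e \; r)) `&` (Y `*` Y)).
  exists (r^-1 \; (e \; r)) => //.
  exact: (coarse_comp cE (coarse_comp cE Er Ee) (coarse_inv cE Er)).
move=> [x y] exy; have [/= Xx Xy] := coarse_sub cE Ee exy.
split=> //=; split; last by split; exact: fXY.
by exists y; [exists x => //; exact: rf|exact: rf].
Qed.

End Pullback.

Lemma large_retraction (T : Type) (X : set T) (E : set (set (T * T))) (Y : set T) :
  coarse_structure X E -> large X E Y ->
  exists2 r, E r & exists f : T -> T,
    [/\ forall x, X x -> Y (f x), forall y, Y y -> f y = y &
        forall x, X x -> r (f x, x)].
Proof.
move=> cE [YX _ [r Er Xr]]; exists r => //.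
have /choice[f fP] (x : T) :
    exists y, X x -> [/\ Y y, Y x -> y = x & r (y, x)].
  (* Points of [Y] choose themselves, as [r] contains the diagonal; other points of [X] choose a
     centre in [Y] of an [r]-ball around them; outside [X] the value is arbitrary. *)
  have [Yx|nYx] := pselect (Y x).
    by exists x => Xx; split=> //; apply: (coarse_diag cE Er); split.
  have [Xx|nXx] := pselect (X x); last by exists x.
  by move: (Xx); rewrite {1}Xr => -[y Yy /xsectionP ryx]; exists y.
exists f; split=> [x Xx|y Yy|x Xx].
- by case: (fP x Xx).
- by case: (fP y (YX y Yy)) => _ /(_ Yy).
- by case: (fP x Xx).
Qed.

Theorem proposition13 (T : Type) (X : set T) (E : set (set (T * T))) (Y : set T) :
  coarse_structure X E ->
  infinite_set X ->
  large X E Y ->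
  vee_decomposable Y (coarse_restr E Y) ->
  vee_decomposable X E.
Proof.
move=> cE _ lY [D0 [D1 [c0 c1 cell0 cell1 ED]]].
have [r Er [f [fXY fid rf]]] := large_retraction cE lY.
have [YX _ _] := lY.
exists (pullback_coarse X f D0), (pullback_coarse X f D1); split.
- exact: (pullback_coarse_structure fXY c0).
- exact: (pullback_coarse_structure fXY c1).
- exact: (pullback_cellular fXY c0 cell0).
- exact: (pullback_cellular fXY c1 cell1).
- rewrite (pullback_coarse_join fXY YX fid c0 c1) -ED.
  by rewrite (pullback_coarse_restr fXY cE Er rf).
Qed.
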